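(* Let $a_1,a_2,a_3,a_4\in\mathbb{C}$ be pairwise distinct and let $c_1,c_2,c_3\in\mathbb{C}$ satisfy $c_1c_2c_3\neq 0$. Then $P_4(\lambda,t)$ is reducible in $\mathbb{C}[\lambda,t]$ (equivalently, $\chi_4(\lambda,w)=P_4(\lambda,w^2)$ is reducible in $\mathbb{C}[\lambda,w]$) if and only if there exists $\kappa\in\mathbb{C}^\times$ such that \[ \begin{aligned} c_1&=\kappa(a_1-a_4)(a_2-a_1),\\ c_2&=-\kappa(a_1-a_3)(a_2-a_4),\\ c_3&=\kappa(a_1-a_4)(a_4-a_3). \end{aligned} \] In that case the factorization is \[ P_4(\lambda,t)=\Bigl[(\lambda+a_1)(\lambda+a_4)+\kappa(a_1-a_4)^2t\Bigr]\Bigl[(\lambda+a_2)(\lambda+a_3)+\kappa(a_2-a_1)(a_4-a_3)t\Bigr]. \] Thus, for every reducible such quartic, the factorization pairs the two endpoints $\{1,4\}$ against the two middle vertices $\{2,3\}$ at $t=0$, i.e. the two factors specialize at $t=0$ to $(\lambda+a_1)(\lambda+a_4)$ and $(\lambda+a_2)(\lambda+a_3)$.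
   Context: For $a_1,\ldots,a_n\in\mathbb{C}$ and squared couplings $c_1,\ldots,c_{n-1}\in\mathbb{C}$, the polynomial $P_n(\lambda,t)\in\mathbb{C}[\lambda,t]$ is defined by the recurrence $P_0=1$, $P_1=\lambda+a_1$, $P_k=(\lambda+a_k)P_{k-1}-t\,c_{k-1}P_{k-2}$ for $2\le k\le n$. If $c_i=b_i^2$, then $\chi_n(\lambda,w):=P_n(\lambda,w^2)=\det(\lambda I+A+wB)$, where $A=\operatorname{diag}(a_1,\ldots,a_n)$ and $B$ is the symmetric tridiagonal matrix with zero diagonal and $B_{i,i+1}=B_{i+1,i}=b_i$. *)

(* Defs.v *)
From HB Require Import structures.
From mathcomp Require Import all_boot all_order all_algebra.
From mathcomp Require Import reals complex.

Set Implicit Arguments.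
Unset Strict Implicit.
Unset Printing Implicit Defensive.

Import GRing.Theory.
Local Open Scope ring_scope.

(* C[lambda, t] is the iterated polynomial ring {poly {poly C}} = C[t][lambda]:
   the outer variable 'X is lambda and the inner one, 'X%:P, is t. *)
Section Bivariate.
Variable C : fieldType.

Definition lam : {poly {poly C}} := 'X.
Definition tvar : {poly {poly C}} := ('X : {poly C})%:P.
Definition cst (z : C) : {poly {poly C}} := z%:P%:P.

(* F(lambda, 0), as a polynomial in C[lambda] *)
Definition at_t0 (F : {poly {poly C}}) : {poly C} := map_poly (horner_eval 0) F.

(* F(lambda, w ^ 2), where the inner variable of the result is w *)
Definition subst_sq (F : {poly {poly C}}) : {poly {poly C}} :=
  map_poly (comp_poly ('X^2 : {poly C})) F.

(* The mathematical a_k, c_k (k >= 1) are a`_k.-1, c`_k.-1. *)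
Fixpoint Ppoly (a c : seq C) (n : nat) {struct n} : {poly {poly C}} :=
  match n with
  | 0 => 1
  | 1 => lam + cst a`_0
  | (k.+1 as k1).+1 =>
      (lam + cst a`_k1) * Ppoly a c k1 - tvar * cst c`_k * Ppoly a c k
  end.

End Bivariate.

Arguments lam {C}.
Arguments tvar {C}.

Definition chipoly (C : fieldType) (a c : seq C) (n : nat) : {poly {poly C}} :=
  subst_sq (Ppoly a c n).

Definition factorization (D : idomainType) (p q r : D) : Prop :=
  [/\ q \isn't a GRing.unit, r \isn't a GRing.unit & p = q * r].

Definition reducible (D : idomainType) (p : D) : Prop :=
  p != 0 /\ exists q r : D, factorization p q r.

Definition quartic_couplings (C : fieldType)
    (a1 a2 a3 a4 c1 c2 c3 kappa : C) : Prop :=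
  [/\ c1 = kappa * (a1 - a4) * (a2 - a1),
      c2 = - kappa * (a1 - a3) * (a2 - a4)
    & c3 = kappa * (a1 - a4) * (a4 - a3)].

Definition outer_factor (C : fieldType) (a1 a4 kappa : C) : {poly {poly C}} :=
  (lam + cst a1) * (lam + cst a4) + cst (kappa * (a1 - a4) ^+ 2) * tvar.

Definition inner_factor (C : fieldType) (a1 a2 a3 a4 kappa : C) : {poly {poly C}} :=
  (lam + cst a2) * (lam + cst a3)
  + cst (kappa * (a2 - a1) * (a4 - a3)) * tvar.

(* Main.v *)
Require Import Defs.
From HB Require Import structures.
From mathcomp Require Import all_boot all_order all_algebra.
From mathcomp Require Import reals complex.
From mathcomp Require Import ring zify.

Set Implicit Arguments.
Unset Strict Implicit.
Unset Printing Implicit Defensive.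

Import GRing.Theory.
Local Open Scope ring_scope.

(** The argument works over an arbitrary field C.  Put t = w ^ 2, and let
    chi(lambda, w) = P4(lambda, w ^ 2); write L_i for lambda + a_i.  Then

      chi = L_1 L_2 L_3 L_4 - w ^ 2 (c_1 L_3 L_4 + c_2 L_1 L_4 + c_3 L_1 L_2)
            + w ^ 4 c_1 c_3,

    which is monic in lambda and has total degree 4.  A factorization of chi in
    C[w][lambda] can be rescaled by a constant so that both factors are monic in
    lambda ([monic_factorization]), hence of lambda-degrees 1 + 3 or 2 + 2.

    A linear factor is a root m(w).  Comparing degrees in w shows that m is
    affine; since the a_i are distinct, the coefficients of w ^ 0 and w ^ 1 in
    chi(m(w), w) = 0 force m to be constant, and the coefficient of w ^ 4 is
    then c_1 c_3, which is nonzero ([chipoly4_no_root]).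

    In the 2 + 2 case degrees in w show that each factor has the form
    f_0(lambda) + w f_1(lambda) + w ^ 2 f_2 with f_0 monic quadratic, f_1
    affine and f_2 constant ([size_quadratic_coefs]).  At w = 0 the factors f_0
    and g_0 split {a_1, a_2, a_3, a_4} into two pairs, and are coprime.  The
    coefficient of w gives f_0 g_1 + f_1 g_0 = 0, so f_1 = g_1 = 0
    ([quadratic_cofactors_even]): both factors are polynomials in w ^ 2, which
    is why chi and P4 are reducible together.  The coefficients of w ^ 2 and
    w ^ 4,

      f_0 g_2 + f_2 g_0 = - (c_1 L_3 L_4 + c_2 L_1 L_4 + c_3 L_1 L_2),
      f_2 g_2 = c_1 c_3,

    evaluated at lambda = - a_i, decide which pairings occur.  The pairing
    12|34 gives c_2 = 0 and 13|24 gives (a_1 - a_4) (a_2 - a_3) = 0; the pairing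
    14|23 gives the stated couplings, with kappa = f_2 / (a_1 - a_4) ^ 2 for the
    factor f with f_0 = L_1 L_4 ([couplings_of_factor]).  The converse is a direct
    expansion.  The factorization of P4 is unique up to constants because c_1
    determines kappa. *)

(** * Degrees of the coefficients of quadratic factors *)

Lemma size_polyD_neq (R : nzSemiRingType) (p q : {poly R}) :
  size p != size q -> size (p + q) = maxn (size p) (size q).
Proof.
by rewrite neq_ltn => /orP[] h; [rewrite addrC|]; rewrite size_polyDl //; lia.
Qed.

(** The hypotheses hold when (X ^ 2 + p X + q) (X ^ 2 + r X + s) is even in the
    variable of p, q, r, s and has total degree 4, with q s of degree exactly 4;
    the conclusion is that each factor has total degree 2.  Since p + r is
    constant, if p had degree d >= 2, so would r, hence q + s would have degree
    2 d; as q s has degree 4, one of q, s would be constant and the other of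
    degree 4, so that d = 2 and p s + q r would have degree 6. *)
Lemma size_quadratic_coefs (C : fieldType) (p q r s : {poly C}) :
  (size (p + r)%R <= 1)%N -> (size (q + s + p * r)%R <= 3)%N ->
  (size (p * s + q * r)%R <= 3)%N -> size (q * s) = 5%N ->
  [/\ (size p <= 2)%N, (size r <= 2)%N, (size q <= 3)%N & (size s <= 3)%N].
Proof.
move=> Hpr H2 H3 H4.
have [q0 s0] : q != 0 /\ s != 0.
  by split; apply/eqP => z; move: H4; rewrite z ?mul0r ?mulr0 size_poly0.
have Hqs : (size q + size s).-1 = 5%N by rewrite -H4 size_mul.
have sq : (0 < size q)%N by rewrite size_poly_gt0.
have ss : (0 < size s)%N by rewrite size_poly_gt0.
have szpr : size p = size r \/ (size p <= 1 /\ size r <= 1)%N.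
  by case: (eqVneq (size p) (size r)) => [|/size_polyD_neq e]; [left|right; lia].
have [sp|sp] := leqP (size p) 2.
  have sr : (size r <= 2)%N by lia.
  have le3 : (size (p * r)%R <= 3)%N.
    by apply: leq_trans (size_polyMleq p r) _; lia.
  have Hq : (size (q + s)%R <= 3)%N.
    rewrite -(addrK (p * r) (q + s)); apply: leq_trans (size_polyD _ _) _.
    by rewrite size_polyN geq_max H2.
  suff [] : (size q <= 3)%N /\ (size s <= 3)%N by [].
  by case: (eqVneq (size q) (size s)) => [|/size_polyD_neq] e; lia.
exfalso.
have er : size r = size p by lia.
have p0 : p != 0 by apply: contraTneq sp => ->; rewrite size_poly0.
have r0 : r != 0 by apply: contraTneq sp => e; rewrite -er e size_poly0.
have e : size (p * r) = (size p + size r).-1 by rewrite size_mul.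
have e2 : size (q + s) = size (p * r).
  by case: (eqVneq (size (q + s)) (size (p * r))) => // /size_polyD_neq; lia.
have e3 : (size (q + s)%R <= maxn (size q) (size s))%N by exact: size_polyD.
case: (eqVneq (size q) (size s)) => [e1|/size_polyD_neq e1]; first by lia.
have eps : size (p * s) = (size p + size s).-1 by rewrite size_mul.
have eqr : size (q * r) = (size q + size r).-1 by rewrite size_mul.
have ne : size (p * s) != size (q * r) by lia.
by move: H3; rewrite size_polyD_neq //; lia.
Qed.

(** * The couplings of a product of two quadratics *)

Lemma quadratic_two_roots (C : fieldType) (p q x y : C) : x != y ->
  x ^+ 2 + p * x + q = 0 -> y ^+ 2 + p * y + q = 0 -> p = - (x + y) /\ q = x * y.
Proof.
rewrite -subr_eq0 => xy hx hy.
have hp : p = - (x + y).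
  apply/(mulfI xy); apply/eqP; rewrite -subr_eq0.
  suff -> : (x - y) * p - (x - y) * - (x + y)
    = (x ^+ 2 + p * x + q) - (y ^+ 2 + p * y + q) by rewrite hx hy subrr.
  ring.
split=> //; apply/eqP; rewrite -subr_eq0 -hx hp; apply/eqP; ring.
Qed.

Lemma linear_two_roots (C : fieldType) (p q x y : C) : x != y ->
  p * x + q = 0 -> p * y + q = 0 -> p = 0 /\ q = 0.
Proof.
rewrite -subr_eq0 => xy hx hy.
have hp : p = 0.
  apply/(mulfI xy); rewrite mulr0 -[RHS](subrr 0) -{1}hx -{1}hy; ring.
by move: hx; rewrite hp mul0r add0r.
Qed.

Lemma no_three_roots (C : fieldType) (p q x y z : C) : x != y -> x != z -> y != z ->
  x ^+ 2 + p * x + q = 0 -> y ^+ 2 + p * y + q = 0 -> z ^+ 2 + p * z + q = 0 -> False.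
Proof.
move=> xy xz yz hx hy hz.
have [p1 _] := quadratic_two_roots xy hx hy.
have [p2 _] := quadratic_two_roots xz hx hz.
by move: yz; rewrite -(inj_eq (addrI x)) -(inj_eq oppr_inj) -p1 -p2 eqxx.
Qed.

(** Let f_0 and g_0 be the monic quadratics with roots - i, - j and - k, - l, all
    distinct.  They are coprime, so f_0 g_1 + f_1 g_0 = 0 with f_1, g_1 of degree at most 1
    is only possible for f_1 = g_1 = 0. *)
Lemma quadratic_cofactors_even (C : fieldType) (i j k l p0 p1 q0 q1 r0 r1 s0 s1 : C) :
  uniq [:: i; j; k; l] ->
  (forall x : C,
     (x ^+ 2 + p0 * x + q0) * (r1 * x + s1)
       + (p1 * x + q1) * (x ^+ 2 + r0 * x + s0) = 0) ->
  (- i) ^+ 2 + p0 * (- i) + q0 = 0 -> (- j) ^+ 2 + p0 * (- j) + q0 = 0 ->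
  (- k) ^+ 2 + r0 * (- k) + s0 = 0 -> (- l) ^+ 2 + r0 * (- l) + s0 = 0 ->
  [/\ p0 = i + j, q0 = i * j, r0 = k + l & s0 = k * l] /\
  [/\ p1 = 0, q1 = 0, r1 = 0 & s1 = 0].
Proof.
rewrite /= !inE !negb_or !andbT => /and3P[/and3P[ij ik il] /andP[jk jl] kl].
move=> E hi hj hk hl.
have N (x y : C) : x != y -> - x != - y by rewrite (inj_eq oppr_inj).
have [ep eq] := quadratic_two_roots (N _ _ ij) hi hj.
have [er es] := quadratic_two_roots (N _ _ kl) hk hl.
have D (x y : C) : x != y -> y - x != 0 by rewrite eq_sym subr_eq0.
rewrite -[LHS]opprK in ep.
have gi (x : C) : x ^+ 2 + r0 * x + s0 = (x + k) * (x + l) by rewrite er es; ring.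
have fi (x : C) : x ^+ 2 + p0 * x + q0 = (x + i) * (x + j).
  by rewrite -[p0]opprK ep eq; ring.
have van x u : x * u = 0 -> u != 0 -> x = 0 :> C.
  by move=> /eqP; rewrite mulf_eq0 => /orP[/eqP|->].
have root x : (x + i) * (x + j) = 0 -> (x + k) * (x + l) != 0 -> p1 * x + q1 = 0.
  by move=> h; apply: van; rewrite -gi; move: (E x); rewrite fi h mul0r add0r.
have root' x : (x + k) * (x + l) = 0 -> (x + i) * (x + j) != 0 -> r1 * x + s1 = 0.
  by move=> h; apply: van; rewrite mulrC -fi; move: (E x); rewrite gi h mulr0 addr0.
split.
  by split=> //; [rewrite -[p0]opprK ep| |rewrite er|rewrite es]; rewrite ?eq; ring.
have [|||-> ->] := @linear_two_roots _ p1 q1 (- i) (- j); first exact: N.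
- by apply: root; rewrite ?addNr ?mul0r // mulf_neq0 // addrC D.
- by apply: root; rewrite ?addNr ?mulr0 // mulf_neq0 // addrC D.
have [|||-> ->] // := @linear_two_roots _ r1 s1 (- k) (- l); first exact: N.
- by apply: root'; rewrite ?addNr ?mul0r // mulf_neq0 // addrC D // eq_sym.
- by apply: root'; rewrite ?addNr ?mulr0 // mulf_neq0 // addrC D // eq_sym.
Qed.

(** The four equations are the coefficients of w ^ 0, w ^ 1, w ^ 2 and w ^ 4 in
    chi(x, w) = F(x, w) G(x, w), for
    F = lambda ^ 2 + p0 lambda + q0 + w (p1 lambda + q1) + w ^ 2 q2 and
    G = lambda ^ 2 + r0 lambda + s0 + w (r1 lambda + s1) + w ^ 2 s2.  The factor
    named F is the one that vanishes at lambda = - a1, w = 0. *)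
Lemma couplings_of_factor (C : fieldType)
    (a1 a2 a3 a4 c1 c2 c3 p0 p1 q0 q1 q2 r0 r1 s0 s1 s2 : C) :
  uniq [:: a1; a2; a3; a4] -> c1 * c2 * c3 != 0 ->
  (forall x : C,
     [/\ (x ^+ 2 + p0 * x + q0) * (x ^+ 2 + r0 * x + s0)
           = (x + a1) * (x + a2) * (x + a3) * (x + a4),
         (x ^+ 2 + p0 * x + q0) * (r1 * x + s1)
           + (p1 * x + q1) * (x ^+ 2 + r0 * x + s0) = 0,
         (x ^+ 2 + p0 * x + q0) * s2 + (p1 * x + q1) * (r1 * x + s1)
           + q2 * (x ^+ 2 + r0 * x + s0)
           = - (c1 * (x + a3) * (x + a4) + c2 * (x + a1) * (x + a4)
                + c3 * (x + a1) * (x + a2))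
       & q2 * s2 = c1 * c3]) ->
  (- a1) ^+ 2 + p0 * (- a1) + q0 = 0 ->
  exists2 kappa, kappa != 0 /\ quartic_couplings a1 a2 a3 a4 c1 c2 c3 kappa &
    [/\ p1 = 0, q1 = 0, r1 = 0 & s1 = 0] /\
    [/\ p0 = a1 + a4, q0 = a1 * a4 & q2 = kappa * (a1 - a4) ^+ 2] /\
    [/\ r0 = a2 + a3, s0 = a2 * a3 & s2 = kappa * (a2 - a1) * (a4 - a3)].
Proof.
move=> U; rewrite !mulf_eq0 !negb_or -andbA => /and3P[c10 c20 c30] E f1.
have := U; rewrite /= !inE !negb_or !andbT.
move=> /and3P[/and3P[n12 n13 n14] /andP[n23 n24] n34].
have root x : (x + a1) * (x + a2) * (x + a3) * (x + a4) = 0 ->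
    x ^+ 2 + p0 * x + q0 = 0 \/ x ^+ 2 + r0 * x + s0 = 0.
  have [<- _ _ _] := E x; move=> /eqP.
  by rewrite mulf_eq0 => /orP[] /eqP; [left|right].
have E1 x : _ := let: And4 _ h _ _ := E x in h.
have E2 x : _ := let: And4 _ _ h _ := E x in h.
have E3 : q2 * s2 = c1 * c3 by case: (E 0).
have N (x y : C) : x != y -> - x != - y by rewrite (inj_eq oppr_inj).
have D (x y : C) : x != y -> x - y != 0 by rewrite subr_eq0.
(* deriving x = y from an equation z = w with the same difference *)
have T (x y z w : C) : z = w -> x - y = z - w -> x = y.
  by move=> ->; rewrite subrr => /eqP; rewrite subr_eq0 => /eqP.
have [|f2|g2] := root (- a2); first by rewrite addNr mulr0 !mul0r.
- have [|f3|g3] := root (- a3); first by rewrite addNr mulr0 mul0r.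
    by have := no_three_roots (N _ _ n12) (N _ _ n13) (N _ _ n23) f1 f2 f3.
  have [|f4|g4] := root (- a4); first by rewrite addNr mulr0.
    by have := no_three_roots (N _ _ n12) (N _ _ n14) (N _ _ n24) f1 f2 f4.
  (* pairing 12|34, excluded by c2 != 0 *)
  have [[ep eq er es] [ep1 eq1 er1 es1]] := quadratic_cofactors_even U E1 f1 f2 g3 g4.
  subst.
  have u : q2 = - c1.
    apply: (mulIf (D _ _ n13)); apply: (mulIf (D _ _ n14)).
    by apply: (T _ _ _ _ (E2 (- a1))); ring.
  have v : s2 = - c3.
    apply: (mulIf (D _ _ n14)); apply: (mulIf (D _ _ n24)).
    by apply: (T _ _ _ _ (E2 (- a4))); ring.
  case/eqP: c20; apply: (mulIf (D _ _ n12)); apply: (mulIf (D _ _ n24)).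
  by apply/esym; apply: (T _ _ _ _ (E2 (- a2))); rewrite u v; ring.
have [|f3|g3] := root (- a3); first by rewrite addNr mulr0 mul0r.
- have [|f4|g4] := root (- a4); first by rewrite addNr mulr0.
    by have := no_three_roots (N _ _ n13) (N _ _ n14) (N _ _ n34) f1 f3 f4.
  (* pairing 13|24, excluded by (a1 - a4) * (a2 - a3) != 0 *)
  have U4 : uniq [:: a1; a3; a2; a4].
    by rewrite /= !inE !negb_or n13 n12 n14 (eq_sym a3) n23 n34 n24.
  have [[ep eq er es] [ep1 eq1 er1 es1]] := quadratic_cofactors_even U4 E1 f1 f3 g2 g4.
  subst.
  have u : q2 * (a1 - a2) = - c1 * (a1 - a3).
    by apply: (mulIf (D _ _ n14)); apply: (T _ _ _ _ (E2 (- a1))); ring.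
  have v : s2 * (a3 - a4) = - c3 * (a2 - a4).
    by apply: (mulIf (D _ _ n14)); apply: (T _ _ _ _ (E2 (- a4))); ring.
  case/eqP: (D _ _ n14); apply: (mulIf (D _ _ n23)).
  apply: (mulIf c10); apply: (mulIf c30).
  have : (q2 * (a1 - a2)) * (s2 * (a3 - a4)) = (- c1 * (a1 - a3)) * (- c3 * (a2 - a4)).
    by rewrite u v.
  have -> : (q2 * (a1 - a2)) * (s2 * (a3 - a4))
      = (q2 * s2) * ((a1 - a2) * (a3 - a4)) by ring.
  by rewrite E3 => /esym h; apply: (T _ _ _ _ h); ring.
have [|f4|g4] := root (- a4); first by rewrite addNr mulr0.
  2: by have := no_three_roots (N _ _ n23) (N _ _ n24) (N _ _ n34) g2 g3 g4.
(* pairing 14|23: solve for c1, c3, then s2, then c2 in terms of q2 *)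
have U4 : uniq [:: a1; a4; a2; a3].
  by rewrite /= !inE !negb_or n13 n12 n14 !(eq_sym a4) n23 n34 n24.
have [[ep eq er es] [ep1 eq1 er1 es1]] := quadratic_cofactors_even U4 E1 f1 f4 g2 g3.
subst.
have d14 := D _ _ n14.
have e1 : c1 = - q2 * (a1 - a2) / (a1 - a4).
  apply: (mulIf d14); apply: (mulIf (D _ _ n13)); rewrite mulfVK //.
  by apply: (T _ _ _ _ (E2 (- a1))); ring.
have e3 : c3 = - q2 * (a3 - a4) / (a1 - a4).
  apply: (mulIf d14); apply: (mulIf (D _ _ n24)); rewrite mulfVK //.
  by apply: (T _ _ _ _ (E2 (- a4))); ring.
have u0 : q2 != 0 by apply: contraNneq c10; rewrite e1 => ->; rewrite oppr0 !mul0r.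
have ev : s2 = q2 * (a1 - a2) * (a3 - a4) / (a1 - a4) ^+ 2.
  by apply: (mulfI u0); rewrite E3 e1 e3; field.
have e2 : c2 = - s2 + q2 * (a3 - a2) / (a1 - a4).
  have -> : - s2 + q2 * (a3 - a2) / (a1 - a4)
      = - s2 - c1 * (a3 - a2) / (a1 - a2) by rewrite e1; field; rewrite d14 D.
  apply: (mulIf (D _ _ n12)); rewrite mulrBl mulfVK ?D //.
  apply: (mulIf (D _ _ n24)); apply/esym; apply: (T _ _ _ _ (E2 (- a2))); ring.
exists (q2 / (a1 - a4) ^+ 2).
  split; first by rewrite mulf_neq0 // invr_neq0 // expf_neq0.
  by split; [rewrite e1|rewrite e2 ev|rewrite e3]; field.
do !split=> //; [by field | rewrite ev; by field].
Qed.

(** * The quartic as a polynomial in lambda and w *)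

Lemma coefs_quartic (R : nzRingType) (u0 u1 u2 u3 u4 v0 v1 v2 v3 v4 : R) :
  u0%:P + u1%:P * 'X + u2%:P * 'X^2 + u3%:P * 'X^3 + u4%:P * 'X^4
  = v0%:P + v1%:P * 'X + v2%:P * 'X^2 + v3%:P * 'X^3 + v4%:P * 'X^4 ->
  [/\ u0 = v0, u1 = v1, u2 = v2, u3 = v3 & u4 = v4].
Proof.
move=> /polyP E.
by split; [move: (E 0) | move: (E 1) | move: (E 2) | move: (E 3) | move: (E 4)];
  rewrite !(coefD, coefCM, coefXn, coefX, coefC) /= ?(mulr0, mulr1, addr0, add0r).
Qed.

Lemma subst_sqD (C : fieldType) (F G : {poly {poly C}}) :
  subst_sq (F + G) = subst_sq F + subst_sq G.
Proof. exact: rmorphD. Qed.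

Lemma subst_sqN (C : fieldType) (F : {poly {poly C}}) : subst_sq (- F) = - subst_sq F.
Proof. exact: rmorphN. Qed.

Lemma subst_sq1 (C : fieldType) : subst_sq 1 = 1 :> {poly {poly C}}.
Proof. exact: rmorph1. Qed.

Lemma subst_sqM (C : fieldType) (F G : {poly {poly C}}) :
  subst_sq (F * G) = subst_sq F * subst_sq G.
Proof. exact: rmorphM. Qed.

Lemma subst_sq_lam (C : fieldType) : subst_sq (@lam C) = lam.
Proof. by rewrite /subst_sq /lam map_polyX. Qed.

Lemma subst_sq_tvar (C : fieldType) : subst_sq (@tvar C) = tvar ^+ 2.
Proof. by rewrite /subst_sq /tvar map_polyC /= comp_polyX rmorphXn. Qed.

Lemma subst_sq_cst (C : fieldType) (x : C) : subst_sq (cst x) = cst x.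
Proof. by rewrite /subst_sq /cst map_polyC /= comp_polyC. Qed.

Definition subst_sqE :=
  (subst_sqD, subst_sqN, subst_sq1, subst_sqM, subst_sq_lam, subst_sq_tvar,
   subst_sq_cst).

Lemma chipoly4E (C : fieldType) (a1 a2 a3 a4 c1 c2 c3 : C) :
  chipoly [:: a1; a2; a3; a4] [:: c1; c2; c3] 4 =
  (lam + cst a1) * (lam + cst a2) * (lam + cst a3) * (lam + cst a4)
  - tvar ^+ 2 * (cst c1 * (lam + cst a3) * (lam + cst a4)
     + cst c2 * (lam + cst a1) * (lam + cst a4)
     + cst c3 * (lam + cst a1) * (lam + cst a2))
  + tvar ^+ 4 * cst (c1 * c3).
Proof.
rewrite /chipoly /= !subst_sqE /cst !polyCM.
ring.
Qed.

Lemma horner_chipoly4 (C : fieldType) (a1 a2 a3 a4 c1 c2 c3 : C) (m : {poly C}) :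
  (chipoly [:: a1; a2; a3; a4] [:: c1; c2; c3] 4).[m] =
  (m + a1%:P) * (m + a2%:P) * (m + a3%:P) * (m + a4%:P)
  - 'X ^+ 2 * (c1%:P * (m + a3%:P) * (m + a4%:P)
     + c2%:P * (m + a1%:P) * (m + a4%:P)
     + c3%:P * (m + a1%:P) * (m + a2%:P))
  + 'X ^+ 4 * (c1 * c3)%:P.
Proof.
rewrite chipoly4E /lam /tvar /cst.
by rewrite !(hornerE, horner_exp).
Qed.

(** The coefficient of lambda ^ (4 - i) in chi has degree at most i in w, and is
    even in w, whence the bounds 1 and 3 on sizes. *)
Lemma chipoly4_coefs (C : fieldType) (a1 a2 a3 a4 c1 c2 c3 : C) :
  exists v0 v1 v2 v3 : {poly C},
  chipoly [:: a1; a2; a3; a4] [:: c1; c2; c3] 4 =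
    v0%:P + v1%:P * 'X + v2%:P * 'X^2 + v3%:P * 'X^3 + 1%:P * 'X^4 /\
  [/\ (size v3 <= 1)%N, (size v2 <= 3)%N, (size v1 <= 3)%N
    & c1 * c3 != 0 -> size v0 = 5].
Proof.
exists ((a1 * a2 * a3 * a4)%:P - (c1 * a3 * a4 + c2 * a1 * a4 + c3 * a1 * a2)%:P * 'X^2
   + (c1 * c3)%:P * 'X^4).
exists ((a1 * a2 * a3 + a1 * a2 * a4 + a1 * a3 * a4 + a2 * a3 * a4)%:P
   - (c1 * (a3 + a4) + c2 * (a1 + a4) + c3 * (a1 + a2))%:P * 'X^2).
exists ((a1 * a2 + a1 * a3 + a1 * a4 + a2 * a3 + a2 * a4 + a3 * a4)%:P
   - (c1 + c2 + c3)%:P * 'X^2).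
exists (a1 + a2 + a3 + a4)%:P.
split.
  rewrite chipoly4E /lam /tvar /cst; ring.
split.
- exact: size_polyC_leq1.
- by apply/leq_sizeP => -[|[|[|j]]] // _;
    rewrite !(coefD, coefN, coefC, coefCM, coefXn) /= mulr0 subr0.
- by apply/leq_sizeP => -[|[|[|j]]] // _;
    rewrite !(coefD, coefN, coefC, coefCM, coefXn) /= mulr0 subr0.
move=> nz.
have sz : size ((c1 * c3)%:P * 'X^4) = 5 by rewrite mul_polyC size_scale // size_polyXn.
rewrite addrC size_polyDl sz // ltnS.
by apply/leq_sizeP => -[|[|[|[|j]]]] // _;
  rewrite !(coefD, coefN, coefC, coefCM, coefXn) /= mulr0 subr0.
Qed.

Lemma monic_quartic_size (R : comNzRingType) (v0 v1 v2 v3 : R) :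
  let P := v0%:P + v1%:P * 'X + v2%:P * 'X^2 + v3%:P * 'X^3 + 1%:P * 'X^4 in
  P \is monic /\ size P = 5.
Proof.
move=> P; have -> : P = Poly [:: v0; v1; v2; v3; 1].
  by rewrite /P /= !cons_poly_def; ring.
have e : Poly [:: v0; v1; v2; v3; 1] = [:: v0; v1; v2; v3; 1] :> seq R.
  by rewrite (@PolyK _ 0) //= oner_eq0.
by rewrite monicE lead_coefE e.
Qed.

Lemma monic_size2 (R : nzRingType) (F : {poly R}) :
  F \is monic -> size F = 2 -> F = 'X + (F`_0)%:P.
Proof.
rewrite monicE lead_coefE => /eqP m s; rewrite s in m.
apply/polyP => -[|[|i]]; rewrite coefD coefX coefC /= ?add0r ?addr0 //.
by rewrite nth_default // s.
Qed.

Lemma monic_size3 (R : nzRingType) (F : {poly R}) :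
  F \is monic -> size F = 3 -> F = 'X^2 + (F`_1)%:P * 'X + (F`_0)%:P.
Proof.
rewrite monicE lead_coefE => /eqP m s; rewrite s in m.
by apply/polyP => -[|[|[|i]]]; rewrite !coefD coefXn coefCM coefX coefC /=
  ?(mulr0, mulr1, add0r, addr0) // nth_default // s.
Qed.

Lemma size2_polyE (R : nzRingType) (p : {poly R}) : (size p <= 2)%N ->
  p = (p`_0)%:P + (p`_1)%:P * 'X.
Proof.
move=> s; apply/polyP => -[|[|i]]; rewrite coefD coefC coefCM coefX /=
  ?(mulr0, mulr1, add0r, addr0) //.
by rewrite nth_default //; apply: leq_trans s _.
Qed.

Lemma size3_polyE (R : nzRingType) (p : {poly R}) : (size p <= 3)%N ->
  p = (p`_0)%:P + (p`_1)%:P * 'X + (p`_2)%:P * 'X^2.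
Proof.
move=> s; apply/polyP => -[|[|[|i]]]; rewrite !coefD coefC !coefCM coefX coefXn /=
  ?(mulr0, mulr1, add0r, addr0) //.
by rewrite nth_default //; apply: leq_trans s _.
Qed.

(** If m had degree d >= 2, the product of the m + a_i would have degree 4 d,
    while the other terms of chi(m(w), w) have degree at most
    max(2 d + 2, 4) < 4 d. *)
Lemma size_root_chipoly4 (C : fieldType) (a1 a2 a3 a4 c1 c2 c3 : C) (m : {poly C}) :
  root (chipoly [:: a1; a2; a3; a4] [:: c1; c2; c3] 4) m -> (size m <= 2)%N.
Proof.
rewrite /root horner_chipoly4 addr_eq0 subr_eq => /eqP E.
case: leqP => // sm; set k := size m in sm.
have sz (a : C) : size (m + a%:P) = k.
  by rewrite size_polyDl //; apply: leq_ltn_trans (size_polyC_leq1 _) _; apply: ltnW.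
have nz (a : C) : m + a%:P != 0 by rewrite -size_poly_gt0 sz; lia.
have term (c a b : C) : (size (c%:P * (m + a%:P) * (m + b%:P))%R <= k + k.-1)%N.
  rewrite -mulrA mul_polyC; apply: leq_trans (size_scale_leq _ _) _.
  by rewrite size_mul // !sz; lia.
have big : size ((m + a1%:P) * (m + a2%:P) * (m + a3%:P) * (m + a4%:P)) = (4 * k - 3)%N.
  by rewrite !size_mul ?mulf_neq0 // !sz; lia.
(* sizes exceed degrees by 1, so k = d + 1 *)
suff : (4 * k - 3 <= 2 * k + 1)%N by lia.
rewrite -big E; apply: leq_trans (size_polyD _ _) _.
rewrite geq_max size_polyN; apply/andP; split.
  rewrite mulrC mul_polyC; apply: leq_trans (size_scale_leq _ _) _.
  by rewrite size_polyXn; lia.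
apply: leq_trans (size_polyMleq _ _) _; rewrite size_polyXn.
suff h : (size (c1%:P * (m + a3%:P) * (m + a4%:P) + c2%:P * (m + a1%:P) * (m + a4%:P)
   + c3%:P * (m + a1%:P) * (m + a2%:P))%R <= k + k.-1)%N.
  by move: h; move: (size _) => n; clear term sz nz; lia.
apply: leq_trans (size_polyD _ _) _; rewrite geq_max term andbT.
by apply: leq_trans (size_polyD _ _) _; rewrite geq_max !term.
Qed.

Lemma chipoly4_no_root (C : fieldType) (a1 a2 a3 a4 c1 c2 c3 : C) (m : {poly C}) :
  uniq [:: a1; a2; a3; a4] -> c1 * c3 != 0 ->
  ~~ root (chipoly [:: a1; a2; a3; a4] [:: c1; c2; c3] 4) m.
Proof.
move=> U c13; apply/negP => rt; have := size2_polyE (size_root_chipoly4 rt).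
move: rt; rewrite /root horner_chipoly4; move: (m`_0) (m`_1) => x e /eqP E Em.
(* the coefficients of chi(x + e w, w) as a polynomial in w *)
have [|e0 e1 _ _ e4] := @coefs_quartic C
   ((x + a1) * (x + a2) * (x + a3) * (x + a4))
   (e * ((x + a2) * (x + a3) * (x + a4) + (x + a1) * (x + a3) * (x + a4)
     + (x + a1) * (x + a2) * (x + a4) + (x + a1) * (x + a2) * (x + a3)))
   (e ^+ 2 * ((x + a1) * (x + a2) + (x + a1) * (x + a3) + (x + a1) * (x + a4)
      + (x + a2) * (x + a3) + (x + a2) * (x + a4) + (x + a3) * (x + a4))
    - (c1 * (x + a3) * (x + a4) + c2 * (x + a1) * (x + a4) + c3 * (x + a1) * (x + a2)))
   (e ^+ 3 * (x + a1 + (x + a2) + (x + a3) + (x + a4))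
    - e * (c1 * (x + a3 + (x + a4)) + c2 * (x + a1 + (x + a4))
           + c3 * (x + a1 + (x + a2))))
   (e ^+ 4 - e ^+ 2 * (c1 + c2 + c3) + c1 * c3)
   0 0 0 0 0.
  by rewrite !mul0r !addr0 -[RHS]E Em; ring.
(* e = 0 leaves only c1 * c3 in the coefficient of w ^ 4 *)
suff e00 : e = 0 by move: e4; rewrite e00 !expr0n /= mul0r subr0 add0r; apply/eqP.
have D (a b : C) : x + a = 0 -> b != a -> x + b != 0.
  by move=> /eqP; rewrite addr_eq0 => /eqP ->; rewrite addrC subr_eq0.
have van (u : C) : e * u = 0 -> u != 0 -> e = 0.
  by move=> /eqP; rewrite mulf_eq0 => /orP[/eqP|->].
move: U; rewrite /= !inE !negb_or !andbT.
move=> /and3P[/and3P[n12 n13 n14] /andP[n23 n24] n34].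
(* one of the x + a_i vanishes, and then e1 is e times the product of the others *)
move/eqP: e0; rewrite !mulf_eq0 -!orbA => /or4P[] /eqP z; move: e1; rewrite z
  !(mul0r, mulr0, add0r, addr0) => /van; apply;
  by rewrite !mulf_neq0 // (D _ _ z) // eq_sym.
Qed.

(** * Factorizations of the quartic *)

Lemma cst_unit (C : fieldType) (x : C) : x != 0 -> cst x \is a GRing.unit.
Proof. by move=> x0; do 2!apply: rmorph_unit; rewrite unitfE. Qed.

(** The leading coefficients in lambda multiply to 1, hence are constants. *)
Lemma monic_factorization (C : fieldType) (P F G : {poly {poly C}}) :
  P \is monic -> factorization P F G ->
  exists2 u : C, u != 0 & exists F' G' : {poly {poly C}},
   [/\ F = cst u * F', G = cst u^-1 * G', P = F' * G',
       F' \is monic /\ (1 < size F')%N & G' \is monic /\ (1 < size G')%N].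
Proof.
move=> mP [nF nG E].
have lFG : lead_coef F * lead_coef G = 1.
  by rewrite -lead_coefM -E; apply/eqP; rewrite -monicE.
have : lead_coef F \is a GRing.unit.
  by apply/unitrP; exists (lead_coef G); rewrite mulrC lFG.
rewrite poly_unitE => /andP[/size_poly1P[u u0 eF] _].
have cK : cst u * cst u^-1 = 1 by rewrite /cst -!polyCM divff.
have cVK : cst u^-1 * cst u = 1 by rewrite mulrC.
have eG : lead_coef G = (u^-1)%:P.
  by rewrite -[RHS]mulr1 -lFG eF mulrA -polyCM mulVf // mul1r.
have one (H : {poly {poly C}}) : H \is monic -> (size H <= 1)%N -> H = 1.
  rewrite monicE => m /size1_polyC e.
  by move: m; rewrite e lead_coefC => /eqP ->.
have mF : cst u^-1 * F \is monic.
  by rewrite monicE lead_coefM lead_coefC eF -polyCM mulVf.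
have mG : cst u * G \is monic.
  by rewrite monicE lead_coefM lead_coefC eG -polyCM divff.
exists u => //; exists (cst u^-1 * F), (cst u * G).
have eF' : F = cst u * (cst u^-1 * F) by rewrite mulrA cK mul1r.
have eG' : G = cst u^-1 * (cst u * G) by rewrite mulrA cVK mul1r.
split=> //.
- by rewrite E mulrACA cVK mul1r.
- split=> //; rewrite ltnNge; apply: contra nF => /(one _ mF) e.
  by rewrite eF' e mulr1 cst_unit.
- split=> //; rewrite ltnNge; apply: contra nG => /(one _ mG) e.
  by rewrite eG' e mulr1 cst_unit // invr_eq0.
Qed.

(** The factors of chi, normalized to be monic in lambda, are even in w and are
    the two stated factors. *)
Lemma monic_factor_chipoly4 (C : fieldType) (a1 a2 a3 a4 c1 c2 c3 : C)
    (F G : {poly {poly C}}) :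
  uniq [:: a1; a2; a3; a4] -> c1 * c2 * c3 != 0 ->
  F \is monic -> G \is monic -> (1 < size F)%N -> (1 < size G)%N ->
  chipoly [:: a1; a2; a3; a4] [:: c1; c2; c3] 4 = F * G ->
  exists2 kappa : C, kappa != 0 /\ quartic_couplings a1 a2 a3 a4 c1 c2 c3 kappa &
    (F = subst_sq (outer_factor a1 a4 kappa) /\
     G = subst_sq (inner_factor a1 a2 a3 a4 kappa)) \/
    (F = subst_sq (inner_factor a1 a2 a3 a4 kappa) /\
     G = subst_sq (outer_factor a1 a4 kappa)).
Proof.
move=> U c0 mF mG sF sG E.
have c13 : c1 * c3 != 0.
  by apply: contraNneq c0 => h; rewrite mulrAC h mul0r.
have noroot H K m : H = 'X + m%:P ->
    chipoly [:: a1; a2; a3; a4] [:: c1; c2; c3] 4 = H * K -> False.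
  move=> -> e; have /negP := chipoly4_no_root c2 (- m) U c13; apply.
  by rewrite e rootM /root !hornerE addNr eqxx.
have [v0 [v1 [v2 [v3 [Ev [sv3 sv2 sv1 sv0]]]]]] := chipoly4_coefs a1 a2 a3 a4 c1 c2 c3.
have [_ schi] := monic_quartic_size v0 v1 v2 v3.
have sFG : (size F + size G)%N = 6.
  have : (size F + size G).-1 = 5%N by rewrite -size_mul ?monic_neq0 // -E Ev.
  by clear noroot; lia.
have [sF2|sF2] := eqVneq (size F) 2.
  by case: (noroot _ _ _ (monic_size2 mF sF2) E).
have [sG2|sG2] := eqVneq (size G) 2.
  by rewrite mulrC in E; case: (noroot _ _ _ (monic_size2 mG sG2) E).
have sF3 : size F = 3 by clear noroot; lia.
have sG3 : size G = 3 by clear noroot; lia.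
have eF := monic_size3 mF sF3; have eG := monic_size3 mG sG3.
move: eF eG; move: (F`_1) (F`_0) (G`_1) (G`_0) => p q r s eF eG.
have [e0 e1 e2 e3 _] : [/\ q * s = v0, p * s + q * r = v1,
    q + s + p * r = v2, p + r = v3 & 1 = 1 :> {poly C}].
  by apply: coefs_quartic; rewrite -Ev E eF eG; ring.
have [||||sp sr sq ss] := @size_quadratic_coefs _ p q r s.
- by rewrite e3.
- by rewrite e2.
- by rewrite e1.
- by rewrite e0 sv0.
have := size2_polyE sp; have := size2_polyE sr.
have := size3_polyE sq; have := size3_polyE ss.
move: (p`_0) (p`_1) (r`_0) (r`_1) (q`_0) (q`_1) (q`_2) (s`_0) (s`_1) (s`_2).
move=> p0 p1 r0 r1 q0 q1 q2 s0 s1 s2 es eq er ep.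
have key (x : C) :
  [/\ (x ^+ 2 + p0 * x + q0) * (x ^+ 2 + r0 * x + s0)
           = (x + a1) * (x + a2) * (x + a3) * (x + a4),
     (x ^+ 2 + p0 * x + q0) * (r1 * x + s1)
           + (p1 * x + q1) * (x ^+ 2 + r0 * x + s0) = 0,
     (x ^+ 2 + p0 * x + q0) * s2 + (p1 * x + q1) * (r1 * x + s1)
           + q2 * (x ^+ 2 + r0 * x + s0)
           = - (c1 * (x + a3) * (x + a4) + c2 * (x + a1) * (x + a4)
                + c3 * (x + a1) * (x + a2)),
     (p1 * x + q1) * s2 + q2 * (r1 * x + s1) = 0
   & q2 * s2 = c1 * c3].
  have h := horner_chipoly4 a1 a2 a3 a4 c1 c2 c3 x%:P.
  rewrite E eF eG hornerM !hornerE ep eq er es in h.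
  by apply: coefs_quartic; apply: etrans (etrans h _); ring.
have := key (- a1) => -[h _ _ _ _].
have /eqP : ((- a1) ^+ 2 + p0 * (- a1) + q0) * ((- a1) ^+ 2 + r0 * (- a1) + s0) = 0.
  by rewrite h addNr !mul0r.
(* the factor that vanishes at lambda = - a1, w = 0 becomes the outer one *)
rewrite mulf_eq0 => /orP[] /eqP root1.
  have [|k hk [[z1 z2 z3 z4] [[z5 z6 z7] [z8 z9 z10]]]] :=
     couplings_of_factor (p1 := p1) (q1 := q1) (q2 := q2)
       (r0 := r0) (r1 := r1) (s0 := s0) (s1 := s1) (s2 := s2) U c0 _ root1.
    by move=> x; case: (key x).
  exists k => //; left; rewrite /outer_factor /inner_factor !subst_sqE.
  by rewrite eF eG ep eq er es; subst; rewrite /lam /tvar /cst; split; ring.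
have [|k hk [[z1 z2 z3 z4] [[z5 z6 z7] [z8 z9 z10]]]] :=
     couplings_of_factor (p1 := r1) (q1 := s1) (q2 := s2)
       (r0 := p0) (r1 := p1) (s0 := q0) (s1 := q1) (s2 := q2) U c0 _ root1.
  move=> x; case: (key x) => k1 k2 k3 _ k5; split; rewrite -?k1 -?k2 -?k3 -?k5; ring.
exists k => //; right; rewrite /outer_factor /inner_factor !subst_sqE.
by rewrite eF eG ep eq er es; subst; rewrite /lam /tvar /cst; split; ring.
Qed.

Lemma chipoly4_monic (C : fieldType) (a1 a2 a3 a4 c1 c2 c3 : C) :
  chipoly [:: a1; a2; a3; a4] [:: c1; c2; c3] 4 \is monic.
Proof.
have [v0 [v1 [v2 [v3 [-> _]]]]] := chipoly4_coefs a1 a2 a3 a4 c1 c2 c3.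
by have [] := monic_quartic_size v0 v1 v2 v3.
Qed.

Lemma factorization_chipoly4 (C : fieldType) (a1 a2 a3 a4 c1 c2 c3 : C)
    (F G : {poly {poly C}}) :
  uniq [:: a1; a2; a3; a4] -> c1 * c2 * c3 != 0 ->
  factorization (chipoly [:: a1; a2; a3; a4] [:: c1; c2; c3] 4) F G ->
  exists2 kappa : C, kappa != 0 /\ quartic_couplings a1 a2 a3 a4 c1 c2 c3 kappa &
  exists2 u : C, u != 0 &
    (F = subst_sq (cst u * outer_factor a1 a4 kappa) /\
     G = subst_sq (cst u^-1 * inner_factor a1 a2 a3 a4 kappa)) \/
    (F = subst_sq (cst u * inner_factor a1 a2 a3 a4 kappa) /\
     G = subst_sq (cst u^-1 * outer_factor a1 a4 kappa)).
Proof.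
move=> U c0 /(monic_factorization (chipoly4_monic _ _ _ _ _ _ _)).
move=> [u u0 [F' [G' [-> -> E [mF sF] [mG sG]]]]].
have [k hk H] := monic_factor_chipoly4 U c0 mF mG sF sG E.
exists k => //; exists u => //.
by case: H => [[-> ->]|[-> ->]]; [left|right]; rewrite !(subst_sqM, subst_sq_cst).
Qed.

Lemma subst_sq_inj (C : fieldType) : injective (@subst_sq C).
Proof.
apply: map_inj_poly; last exact: comp_poly0.
apply: raddf_inj => p /eqP; rewrite comp_poly_eq0 ?size_polyXn // => /eqP //.
Qed.

Lemma unit_cstP (C : fieldType) (H : {poly {poly C}}) :
  reflect (exists2 u : C, u != 0 & H = cst u) (H \is a GRing.unit).
Proof.
apply: (iffP idP) => [|[u u0 ->]]; last exact: cst_unit.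
rewrite poly_unitE => /andP[/size_poly1P[h _ ->]].
rewrite coefC /= poly_unitE => /andP[/size_poly1P[u u0 ->] _].
by exists u.
Qed.

Lemma factorization_subst_sq (C : fieldType) (P F G : {poly {poly C}}) :
  factorization P F G -> factorization (subst_sq P) (subst_sq F) (subst_sq G).
Proof.
have nu (H : {poly {poly C}}) : H \isn't a GRing.unit -> subst_sq H \isn't a GRing.unit.
  apply: contra => /unit_cstP[u u0 e]; apply/unit_cstP; exists u => //.
  by apply: subst_sq_inj; rewrite e subst_sq_cst.
by move=> [nF nG ->]; split; [exact: nu|exact: nu|rewrite subst_sqM].
Qed.

Lemma factorization_Ppoly4 (C : fieldType) (a1 a2 a3 a4 c1 c2 c3 : C)
    (F G : {poly {poly C}}) :
  uniq [:: a1; a2; a3; a4] -> c1 * c2 * c3 != 0 ->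
  factorization (Ppoly [:: a1; a2; a3; a4] [:: c1; c2; c3] 4) F G ->
  exists2 kappa : C, kappa != 0 /\ quartic_couplings a1 a2 a3 a4 c1 c2 c3 kappa &
  exists2 u : C, u != 0 &
    (F = cst u * outer_factor a1 a4 kappa /\
     G = cst u^-1 * inner_factor a1 a2 a3 a4 kappa) \/
    (F = cst u * inner_factor a1 a2 a3 a4 kappa /\
     G = cst u^-1 * outer_factor a1 a4 kappa).
Proof.
move=> U c0 /factorization_subst_sq /(factorization_chipoly4 U c0)[k hk [u u0 H]].
exists k => //; exists u => //.
by case: H => -[/subst_sq_inj -> /subst_sq_inj ->]; [left|right].
Qed.

(** * Specialization at t = 0 *)

Lemma at_t0D (C : fieldType) (F G : {poly {poly C}}) :
  at_t0 (F + G) = at_t0 F + at_t0 G.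
Proof. exact: rmorphD. Qed.

Lemma at_t0M (C : fieldType) (F G : {poly {poly C}}) :
  at_t0 (F * G) = at_t0 F * at_t0 G.
Proof. exact: rmorphM. Qed.

Lemma at_t0_lam (C : fieldType) : at_t0 (@lam C) = 'X.
Proof. by rewrite /at_t0 /lam map_polyX. Qed.

Lemma at_t0_tvar (C : fieldType) : at_t0 (@tvar C) = 0.
Proof. by rewrite /at_t0 /tvar map_polyC /= /horner_eval hornerX polyC0. Qed.

Lemma at_t0_cst (C : fieldType) (x : C) : at_t0 (cst x) = x%:P.
Proof. by rewrite /at_t0 /cst map_polyC /= /horner_eval hornerC. Qed.

Definition at_t0E :=
  (at_t0D, at_t0M, at_t0_lam, at_t0_tvar, at_t0_cst).

Lemma at_t0_outer_factor (C : fieldType) (a1 a4 kappa : C) :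
  at_t0 (outer_factor a1 a4 kappa) = ('X + a1%:P) * ('X + a4%:P).
Proof. by rewrite /outer_factor !at_t0E mulr0 addr0. Qed.

Lemma at_t0_inner_factor (C : fieldType) (a1 a2 a3 a4 kappa : C) :
  at_t0 (inner_factor a1 a2 a3 a4 kappa) = ('X + a2%:P) * ('X + a3%:P).
Proof. by rewrite /inner_factor !at_t0E mulr0 addr0. Qed.

Lemma nonunit_at_t0 (C : fieldType) (F : {poly {poly C}}) :
  (1 < size (at_t0 F))%N -> F \isn't a GRing.unit.
Proof.
move=> s; apply/negP => /unit_cstP[u _ e].
by move: s; rewrite e at_t0_cst ltnNge size_polyC_leq1.
Qed.

(** * Reducibility and uniqueness of the factorization *)

Lemma factorization_outer_inner (C : fieldType) (a1 a2 a3 a4 c1 c2 c3 kappa : C) :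
  quartic_couplings a1 a2 a3 a4 c1 c2 c3 kappa ->
  factorization (Ppoly [:: a1; a2; a3; a4] [:: c1; c2; c3] 4)
    (outer_factor a1 a4 kappa) (inner_factor a1 a2 a3 a4 kappa).
Proof.
have s2 (a b : C) : size (('X + a%:P) * ('X + b%:P)) = 3.
  by rewrite size_mul ?monic_neq0 ?monicXaddC // !size_XaddC.
move=> [-> -> ->]; split.
- by apply: nonunit_at_t0; rewrite at_t0_outer_factor s2.
- by apply: nonunit_at_t0; rewrite at_t0_inner_factor s2.
rewrite /outer_factor /inner_factor /= /lam /tvar /cst; ring.
Qed.

(** The equation for c1 determines kappa as soon as c1 is nonzero. *)
Lemma quartic_couplings_inj (C : fieldType) (a1 a2 a3 a4 c1 c2 c3 k k' : C) :
  c1 != 0 -> quartic_couplings a1 a2 a3 a4 c1 c2 c3 k ->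
  quartic_couplings a1 a2 a3 a4 c1 c2 c3 k' -> k = k'.
Proof.
move=> c0 [e _ _] [e' _ _]; move: c0; rewrite {1}e -mulrA mulf_eq0 => /norP[_ d].
by apply: (mulIf d); rewrite !mulrA -e -e'.
Qed.

Lemma Ppoly4_neq0 (C : fieldType) (a1 a2 a3 a4 c1 c2 c3 : C) :
  Ppoly [:: a1; a2; a3; a4] [:: c1; c2; c3] 4 != 0.
Proof.
have := monic_neq0 (chipoly4_monic a1 a2 a3 a4 c1 c2 c3).
by apply: contraNneq; rewrite /chipoly => ->; rewrite /subst_sq rmorph0.
Qed.

Lemma reducible_Ppoly4P (C : fieldType) (a1 a2 a3 a4 c1 c2 c3 : C) :
  uniq [:: a1; a2; a3; a4] -> c1 * c2 * c3 != 0 ->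
  reducible (Ppoly [:: a1; a2; a3; a4] [:: c1; c2; c3] 4) <->
  exists2 kappa : C, kappa != 0 & quartic_couplings a1 a2 a3 a4 c1 c2 c3 kappa.
Proof.
move=> U c0; split=> [[_ [F [G h]]]|[k _ hk]].
  by have [k [k0 hk] _] := factorization_Ppoly4 U c0 h; exists k.
split; first exact: Ppoly4_neq0.
exists (outer_factor a1 a4 k), (inner_factor a1 a2 a3 a4 k).
exact: factorization_outer_inner.
Qed.

(** A factorization of chi yields the couplings, hence a factorization of P4. *)
Lemma reducible_chipoly4P (C : fieldType) (a1 a2 a3 a4 c1 c2 c3 : C) :
  uniq [:: a1; a2; a3; a4] -> c1 * c2 * c3 != 0 ->
  reducible (chipoly [:: a1; a2; a3; a4] [:: c1; c2; c3] 4) <->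
  reducible (Ppoly [:: a1; a2; a3; a4] [:: c1; c2; c3] 4).
Proof.
move=> U c0; split=> -[_ [F [G h]]].
  have [k [k0 hk] _] := factorization_chipoly4 U c0 h.
  by apply/(reducible_Ppoly4P U c0); exists k.
split; first exact: monic_neq0 (chipoly4_monic _ _ _ _ _ _ _).
by exists (subst_sq F), (subst_sq G); exact: factorization_subst_sq.
Qed.

Lemma factorization_Ppoly4_unique (C : fieldType) (a1 a2 a3 a4 c1 c2 c3 k : C)
    (F G : {poly {poly C}}) :
  uniq [:: a1; a2; a3; a4] -> c1 * c2 * c3 != 0 ->
  quartic_couplings a1 a2 a3 a4 c1 c2 c3 k ->
  factorization (Ppoly [:: a1; a2; a3; a4] [:: c1; c2; c3] 4) F G ->
  exists2 u : C, u != 0 &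
    (F = cst u * outer_factor a1 a4 k /\
     G = cst u^-1 * inner_factor a1 a2 a3 a4 k) \/
    (F = cst u * inner_factor a1 a2 a3 a4 k /\
     G = cst u^-1 * outer_factor a1 a4 k).
Proof.
move=> U c0 hk /(factorization_Ppoly4 U c0)[k' [_ hk'] H].
suff -> : k = k' by [].
apply: quartic_couplings_inj hk hk'.
by move: c0; rewrite !mulf_eq0 !negb_or => /andP[/andP[]].
Qed.

Lemma factorization_Ppoly4_at_t0 (C : fieldType) (a1 a2 a3 a4 c1 c2 c3 : C)
    (F G : {poly {poly C}}) :
  uniq [:: a1; a2; a3; a4] -> c1 * c2 * c3 != 0 ->
  factorization (Ppoly [:: a1; a2; a3; a4] [:: c1; c2; c3] 4) F G ->
  exists2 u : C, u != 0 &
    (at_t0 F = u *: (('X + a1%:P) * ('X + a4%:P)) /\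
     at_t0 G = u^-1 *: (('X + a2%:P) * ('X + a3%:P))) \/
    (at_t0 F = u *: (('X + a2%:P) * ('X + a3%:P)) /\
     at_t0 G = u^-1 *: (('X + a1%:P) * ('X + a4%:P))).
Proof.
move=> U c0 /(factorization_Ppoly4 U c0)[k _ [u u0 H]].
exists u => //; case: H => -[-> ->]; [left|right];
  by rewrite !at_t0M !at_t0_cst !mul_polyC at_t0_outer_factor at_t0_inner_factor.
Qed.

Theorem theorem4p3 (R : realType) (a1 a2 a3 a4 c1 c2 c3 : R[i])
    (a_distinct : uniq [:: a1; a2; a3; a4]) (c_neq0 : c1 * c2 * c3 != 0) :
  let P4 := Ppoly [:: a1; a2; a3; a4] [:: c1; c2; c3] 4 in
  let chi4 := chipoly [:: a1; a2; a3; a4] [:: c1; c2; c3] 4 in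
  let f14 : {poly R[i]} := ('X + a1%:P) * ('X + a4%:P) in
  let f23 : {poly R[i]} := ('X + a2%:P) * ('X + a3%:P) in
  [/\ reducible P4 <->
        (exists2 kappa : R[i], kappa != 0 &
           quartic_couplings a1 a2 a3 a4 c1 c2 c3 kappa),
      reducible chi4 <-> reducible P4,
      forall kappa : R[i], kappa != 0 ->
        quartic_couplings a1 a2 a3 a4 c1 c2 c3 kappa ->
        let F14 := outer_factor a1 a4 kappa in
        let F23 := inner_factor a1 a2 a3 a4 kappa in
        [/\ factorization P4 F14 F23,
            at_t0 F14 = f14,
            at_t0 F23 = f23
          & forall F G, factorization P4 F G ->
              exists2 u : R[i], u != 0 &
                (F = cst u * F14 /\ G = cst u^-1 * F23) \/
                (F = cst u * F23 /\ G = cst u^-1 * F14)]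
    & forall F G, factorization P4 F G ->
        exists2 u : R[i], u != 0 &
          (at_t0 F = u *: f14 /\ at_t0 G = u^-1 *: f23) \/
          (at_t0 F = u *: f23 /\ at_t0 G = u^-1 *: f14)].
Proof.
split.
- exact: reducible_Ppoly4P.
- exact: reducible_chipoly4P.
- move=> kappa _ hk; split.
  + exact: factorization_outer_inner.
  + exact: at_t0_outer_factor.
  + exact: at_t0_inner_factor.
  + by move=> F G; exact: factorization_Ppoly4_unique.
- by move=> F G; exact: factorization_Ppoly4_at_t0.
Qed.
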